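(* Let $E_1,\ldots,E_m$ be (real) Banach lattices, let $G$ be a Banach space, and let $A\colon E_1\times\cdots\times E_m\longrightarrow G$ be a continuous $m$-linear operator of finite rank. Then, for every permutation $\rho\in S_m$, the Aron-Berner extension $AB_m^\rho(A)\colon E_1^{**}\times\cdots\times E_m^{**}\longrightarrow G^{**}$ is of finite rank, and hence separately almost Dunford-Pettis.
   Context: A map with values in a linear space has finite rank if the linear span of its range is finite dimensional. A sequence $(x_n)$ in a Banach lattice is disjoint if $|x_n|\wedge|x_k|=0$ for $n\ne k$. A bounded linear operator from a Banach lattice $E$ to a Banach space $G$ is almost Dunford-Pettis if it sends disjoint weakly null sequences in $E$ to norm null sequences in $G$. An $m$-linear operator $A\colon E_1\times\cdots\times E_m\to G$ ($E_i$ Banach lattices, $G$ Banach space) is separately almost Dunford-Pettis if for each $j$ and all fixed $x_i\in E_i$, $i\ne j$, the linear operator $x_j\in E_j\mapsto A(x_1,\ldots,x_m)\in G$ is almost Dunford-Pettis. Aron-Berner extensions: let $E_1,\ldots,E_m,F$ be real Banach spaces and $\rho\in S_m$ a permutation of $\{1,\ldots,m\}$. For $k=0,\ldots,m$ let $\mathcal{L}_k^\rho$ be the space of continuous $(m-k)$-linear real forms in the variables $x_i\in E_i$, $i\notin\{\rho(1),\ldots,\rho(k)\}$, kept in increasing order of index (so $\mathcal{L}_0^\rho=\mathcal{L}(E_1,\ldots,E_m)$ and $\mathcal{L}_m^\rho=\mathbb{R}$). For $x^{**}_{\rho(k)}\in E_{\rho(k)}^{**}$, the linear operator $\overline{x^{**}_{\rho(k)}}^{\rho}\colon\mathcal{L}_{k-1}^\rho\to\mathcal{L}_k^\rho$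 is defined as follows: the value of $\overline{x^{**}_{\rho(k)}}^{\rho}(B)$ at $(x_i)_{i\notin\{\rho(1),\ldots,\rho(k)\}}$ is $x^{**}_{\rho(k)}$ applied to the functional on $E_{\rho(k)}$ obtained from $B$ by fixing these $x_i$ and leaving the $\rho(k)$-th variable free. For a continuous $m$-linear $A\colon E_1\times\cdots\times E_m\to F$, the Aron-Berner extension $AB_m^\rho(A)\colon E_1^{**}\times\cdots\times E_m^{**}\to F^{**}$ is $$AB_m^\rho(A)(x_1^{**},\ldots,x_m^{**})(y^* )=\big(\overline{x^{**}_{\rho(m)}}^{\rho}\circ\cdots\circ\overline{x^{**}_{\rho(1)}}^{\rho}\big)(y^*\circ A),\quad y^*\in F^*.$$ *)

(* Defs.v *)
From HB Require Import structures.
From mathcomp Require Import all_boot all_order all_algebra all_fingroup.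
From mathcomp Require Import mathcomp_extra boolp classical_sets functions reals.
From mathcomp Require Import topology normedtype sequences.

Set Implicit Arguments.
Unset Strict Implicit.
Unset Printing Implicit Defensive.

Import Order.TTheory GRing.Theory Num.Theory.
Import numFieldNormedType.Exports.

Local Open Scope classical_set_scope.
Local Open Scope ring_scope.

(******************************************************************************)
(* Norm dual of a real normed space                                           *)
(******************************************************************************)

Section LinearBounded.
Variables (R : realType) (V W : normedModType R).

Lemma linear_lin0 (f : V -> W) : linear f -> f 0 = 0.
Proof. by move=> fl; have := fl (-1) 0 0; rewrite scaler0 addr0 scaleN1r addNr. Qed.

Lemma linear_linZ (f : V -> W) a x : linear f -> f (a *: x) = a *: f x.
Proof. by move=> fl; have := fl a x 0; rewrite !addr0 (linear_lin0 fl) addr0. Qed.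

Lemma linear_linD (f : V -> W) x y : linear f -> f (x + y) = f x + f y.
Proof. by move=> fl; have := fl 1 x y; rewrite !scale1r. Qed.

Lemma linear_linN (f : V -> W) x : linear f -> f (- x) = - f x.
Proof. by move=> fl; rewrite -scaleN1r linear_linZ// scaleN1r. Qed.

Lemma linear_linB (f : V -> W) x y : linear f -> f (x - y) = f x - f y.
Proof. by move=> fl; rewrite linear_linD// linear_linN. Qed.

Definition lin_pack (f : V -> W) (fl : linear f) : {linear V -> W} :=
  HB.pack f (GRing.isLinear.Build _ _ _ _ f fl).

Lemma linear_bounded_cts (f : V -> W) (M : R) : linear f ->
  (forall x, `|f x| <= M * `|x|) -> continuous f.
Proof.
move=> fl fM; apply: (@bounded_linear_continuous R V W (lin_pack fl)).
apply/linear_boundedP; near=> r => x /=; rewrite (le_trans (fM x))//.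
by rewrite ler_wpM2r//; near: r; apply: nbhs_pinfty_ge; exact: num_real.
Unshelve. all: by end_near. Qed.

Lemma linear_cts_bounded (f : V -> W) : linear f -> continuous f ->
  exists2 M : R, 0 <= M & forall x, `|f x| <= M * `|x|.
Proof.
move=> fl /(_ 0) fc.
have /linear_boundedP/pinfty_ex_gt0[M M0 fM] :=
  @continuous_linear_bounded R V W 0 (lin_pack fl) fc.
by exists M => //; exact: ltW.
Qed.

End LinearBounded.

Section Dual.
Variables (R : realType) (E : normedModType R).

Definition dual_pred : {pred (E -> R^o)} :=
  fun f => `[< linear f /\ continuous f >].

Record dual : predArgType :=
  Dual { dual_fun :> E -> R^o ; dualP : dual_fun \in dual_pred }.

HB.instance Definition _ := [isSub for dual_fun].
HB.instance Definition _ := gen_eqMixin dual.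
HB.instance Definition _ := [Choice of dual by <:].

Lemma dual_linear (f : dual) : linear f.
Proof. by have /asboolP[] := dualP f. Qed.

Lemma dual_continuous (f : dual) : continuous f.
Proof. by have /asboolP[] := dualP f. Qed.

Lemma dual_ext (f g : dual) : f =1 g -> f = g.
Proof. by move=> fg; apply: val_inj; apply/funext. Qed.

Lemma dual_predP (f : E -> R^o) (M : R) : linear f ->
  (forall x, `|f x| <= M * `|x|) -> f \in dual_pred.
Proof. by move=> fl fM; apply/asboolP; split=> //; exact: linear_bounded_cts fM. Qed.

Lemma dual_submod_closed : submod_closed dual_pred.
Proof.
split.
  by apply: (@dual_predP _ 0) => [a x y|x] /=;
    rewrite ?scaler0 ?addr0 // normr0 mul0r.
move=> a f g /asboolP[fl fc] /asboolP[gl gc].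
have fgE x : (a *: f + g) x = a *: f x + g x by [].
have [M M0 fM] := linear_cts_bounded fl fc.
have [N N0 gN] := linear_cts_bounded gl gc.
apply: (@dual_predP _ (`|a| * M + N)) => [b x y|x].
  by rewrite !fgE fl gl !scalerDr !scalerA (mulrC a) addrACA.
rewrite fgE (le_trans (ler_normD _ _))// mulrDl lerD//.
by rewrite normrZ -mulrA ler_wpM2l.
Qed.

HB.instance Definition _ :=
  GRing.isSubmodClosed.Build R (E -> R^o) dual_pred dual_submod_closed.
HB.instance Definition _ := [SubChoice_isSubLmodule of dual by <:].

Lemma dualDE (f g : dual) x : (f + g) x = f x + g x. Proof. by []. Qed.
Lemma dualNE (f : dual) x : (- f) x = - f x. Proof. by []. Qed.
Lemma dualBE (f g : dual) x : (f - g) x = f x - g x. Proof. by []. Qed.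
Lemma dualZE a (f : dual) x : (a *: f) x = a * f x. Proof. by []. Qed.
Lemma dual0E x : (0 : dual) x = 0. Proof. by []. Qed.

Definition dual_norm (f : dual) : R := sup [set `|f x| | x in [set x | `|x| <= 1]].

Lemma dual_norm_has_sup (f : dual) :
  has_sup [set `|f x| | x in [set x : E | `|x| <= 1]].
Proof.
split; first by exists `|f 0|, 0 => //=; rewrite normr0.
have [M M0 fM] := linear_cts_bounded (@dual_linear f) (@dual_continuous f).
exists M => _ /= [x x1 <-]; rewrite (le_trans (fM x))//.
by rewrite -[leRHS]mulr1 ler_wpM2l.
Qed.

Lemma dual_norm_ub (f : dual) x : `|f x| <= dual_norm f * `|x|.
Proof.
have [->|x0] := eqVneq x 0.
  by rewrite (linear_lin0 (@dual_linear f)) !normr0 mulr0.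
have nx0 : 0 < `|x| by rewrite normr_gt0.
rewrite -ler_pdivrMr// mulrC.
have -> : `|x|^-1 * `|f x| = `|f (`|x|^-1 *: x)|.
  by rewrite (linear_linZ _ _ (@dual_linear f)) normrZ gtr0_norm// invr_gt0.
apply: (sup_upper_bound (dual_norm_has_sup f)).
by exists (`|x|^-1 *: x) => //=; rewrite normfZV.
Qed.

Lemma dual_norm_le (f : dual) M :
  (forall x, `|x| <= 1 -> `|f x| <= M) -> dual_norm f <= M.
Proof.
move=> fM; apply: ge_sup; first by case: (dual_norm_has_sup f).
by move=> _ [x /= /fM ? <-].
Qed.

Lemma dual_norm_ge0 (f : dual) : 0 <= dual_norm f.
Proof.
have h := sup_upper_bound (dual_norm_has_sup f).
by rewrite (le_trans (normr_ge0 (f 0)))//; apply: h; exists 0 => //=; rewrite normr0.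
Qed.

Let dual_normD f g : dual_norm (f + g) <= dual_norm f + dual_norm g.
Proof.
apply: dual_norm_le => x x1; rewrite dualDE (le_trans (ler_normD _ _))//.
by rewrite lerD// (le_trans (dual_norm_ub _ _))// -[leRHS]mulr1 ler_wpM2l// dual_norm_ge0.
Qed.

Let dual_norm_ub1 (f : dual) x : `|x| <= 1 -> `|f x| <= dual_norm f.
Proof.
by move=> x1; rewrite (le_trans (dual_norm_ub _ _))// -[leRHS]mulr1 ler_wpM2l// dual_norm_ge0.
Qed.

Let dual_norm_eq0 f : dual_norm f = 0 -> f = 0.
Proof.
move=> f0; apply: dual_ext => x; apply/eqP; rewrite -normr_le0.
by rewrite (le_trans (dual_norm_ub _ _))// f0 mul0r.
Qed.

Let dual_normZ a f : dual_norm (a *: f) = `|a| * dual_norm f.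
Proof.
have le b g : dual_norm (b *: g) <= `|b| * dual_norm g.
  apply: dual_norm_le => x x1.
  by rewrite dualZE normrM ler_wpM2l// dual_norm_ub1.
apply/eqP; rewrite eq_le le /=.
have [->|a0] := eqVneq a 0; first by rewrite normr0 mul0r dual_norm_ge0.
rewrite -ler_pdivlMl ?normr_gt0// -normfV.
by rewrite (le_trans _ (le _ _))// scalerA mulVf// scale1r.
Qed.

HB.instance Definition _ :=
  Lmodule_isNormed.Build R dual dual_normD dual_normZ dual_norm_eq0.

Lemma dual_normE (f : dual) : `|f| = dual_norm f. Proof. by []. Qed.

Lemma dual_ub (f : dual) x : `|f x| <= `|f| * `|x|.
Proof. exact: dual_norm_ub. Qed.

Lemma dual_complete (F : set_system dual) :
  ProperFilter F -> cauchy F -> cvg F.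
Proof.
move=> FF /cauchy_ballP Fc.
have Fe e : 0 < e -> \forall g \near F, \forall h \near F, `|g - h| <= e.
  move=> e0; have /nearP_dep := Fc e e0; apply: filterS => g.
  by apply: filterS => h; rewrite -ball_normE /= => /ltW.
have Fx x : cvg ((fun g : dual => (g x : R^o)) @ F).
  apply: cauchy_cvg; apply: cauchy_exP => e e0.
  have x1 : 0 < `|x| + 1 by rewrite ltr_wpDl.
  have [g gP] := filter_ex (Fe (e / (`|x| + 1)) (divr_gt0 e0 x1)).
  exists (g x); apply: filterS gP => h gh.
  rewrite -ball_normE /ball_ /= -dualBE (le_lt_trans (dual_ub _ _))//.
  rewrite (@le_lt_trans _ _ (e / (`|x| + 1) * `|x|))// ?ler_wpM2r//.
  by rewrite mulrAC -mulrA gtr_pMr// ltr_pdivrMr// mul1r ltrDl.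
pose f x : R^o := lim ((fun g : dual => (g x : R^o)) @ F).
have fP x : (fun g : dual => (g x : R^o)) @ F --> f x by exact: Fx.
have fl : linear f.
  move=> a x y; apply/cvg_lim => //.
  rewrite (_ : (fun g : dual => _) = fun g : dual => a *: (g x : R^o) + g y).
    by apply: cvgD; [apply: cvgZl_tmp; exact: fP|exact: fP].
  by apply/funext => g; rewrite dual_linear.
have fe e : 0 < e -> \forall g \near F, forall x, `|dual_fun g x - f x| <= e * `|x|.
  move=> e0; have := Fe e e0; apply: filterS => g gh x.
  have : (fun h : dual => `|g x - h x|) @ F --> `|g x - f x|.
    by apply: cvg_norm; apply: cvgB; [exact: cvg_cst|exact: fP].
  move/cvgr_to_le; apply; apply: filterS gh => h gh.
  by rewrite -dualBE (le_trans (dual_ub _ _))// ler_wpM2r.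
have fD : f \in dual_pred.
  have [g gP] := filter_ex (fe 1 ltr01).
  apply: (@dual_predP _ (1 + `|g|)) => // x.
  rewrite -[f x](subrK (g x)) (le_trans (ler_normD _ _))// mulrDl.
  by rewrite lerD ?dual_ub// distrC.
apply/cvg_ex; exists (Dual fD); apply/cvgrPdist_le => e e0.
have := fe e e0; apply: filterS => g gP; apply: dual_norm_le => x x1.
by rewrite dualBE distrC (le_trans (gP x))// -[leRHS]mulr1 ler_wpM2l// ltW.
Qed.

HB.instance Definition _ := Uniform_isComplete.Build dual dual_complete.

End Dual.

(******************************************************************************)
(* Banach lattices                                                            *)
(******************************************************************************)

Reserved Notation "x <=L y" (at level 70, no associativity).

(* Order.Lattice cannot be joined to NormedModule without being placed below   *)
(* RealDomain in the hierarchy of the library, so the lattice order is carried *)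
(* by the mixin, with the axioms of Order.Lattice.                             *)
HB.mixin Record isBanachLattice (R : realType) E of CompleteNormedModule R E := {
  bl_le : E -> E -> Prop ;
  bl_meet : E -> E -> E ;
  bl_join : E -> E -> E ;
  bl_le_refl : forall x, bl_le x x ;
  bl_le_anti : forall x y, bl_le x y -> bl_le y x -> x = y ;
  bl_le_trans : forall y x z, bl_le x y -> bl_le y z -> bl_le x z ;
  bl_lexI : forall x y z, bl_le x (bl_meet y z) <-> bl_le x y /\ bl_le x z ;
  bl_leUx : forall x y z, bl_le (bl_join x y) z <-> bl_le x z /\ bl_le y z ;
  bl_leD2r : forall z x y, bl_le x y -> bl_le (x + z) (y + z) ;
  bl_leZ : forall (a : R) x y, 0 <= a -> bl_le x y -> bl_le (a *: x) (a *: y) ;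
  bl_le_norm : forall x y,
    bl_le (bl_join x (- x)) (bl_join y (- y)) -> `|x| <= `|y|
}.

#[short(type="banachLatticeType")]
HB.structure Definition BanachLattice (R : realType) :=
  {E of CompleteNormedModule R E & isBanachLattice R E}.

Notation "x <=L y" := (bl_le x y) : ring_scope.
Arguments bl_le_anti {R s} [x y].
Arguments bl_le_trans {R s} [y x z].
Arguments bl_leD2r {R s} z [x y].
Arguments bl_leZ {R s} [a x y].

Section BanachLatticeTheory.
Variables (R : realType) (E : banachLatticeType R).
Implicit Types (x y z : E).

(* the modulus |x|; the notation `|x| stands for the norm of x *)
Definition modulus x : E := bl_join x (- x).

Lemma bl_leUl x y : x <=L bl_join x y.
Proof. by have /bl_leUx[] := bl_le_refl (bl_join x y). Qed.
Lemma bl_leUr x y : y <=L bl_join x y.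
Proof. by have /bl_leUx[] := bl_le_refl (bl_join x y). Qed.
Lemma bl_leIl x y : bl_meet x y <=L x.
Proof. by have /bl_lexI[] := bl_le_refl (bl_meet x y). Qed.
Lemma bl_leIr x y : bl_meet x y <=L y.
Proof. by have /bl_lexI[] := bl_le_refl (bl_meet x y). Qed.

Lemma bl_leD2 z x y : x + z <=L y + z <-> x <=L y.
Proof.
split; last exact: bl_leD2r.
by move=> /(bl_leD2r (- z)); rewrite !addrK.
Qed.

Lemma bl_subr_ge0 x y : 0 <=L y - x <-> x <=L y.
Proof. by rewrite -(bl_leD2 x) add0r subrK. Qed.

Lemma bl_leD x1 y1 x2 y2 : x1 <=L y1 -> x2 <=L y2 -> x1 + x2 <=L y1 + y2.
Proof.
move=> h1 h2; apply: (@bl_le_trans _ _ (y1 + x2)); first exact/bl_leD2.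
by rewrite ![y1 + _]addrC; exact/bl_leD2.
Qed.

Lemma bl_leN2 x y : - x <=L - y <-> y <=L x.
Proof. by rewrite -bl_subr_ge0 opprK addrC bl_subr_ge0. Qed.

Lemma bl_addr_ge0 x y : 0 <=L x -> 0 <=L y -> 0 <=L x + y.
Proof. by move=> x0 y0; have := bl_leD x0 y0; rewrite addr0. Qed.

Lemma bl_scale_ge0 (a : R) x : 0 <= a -> 0 <=L x -> 0 <=L a *: x.
Proof. by move=> a0 x0; have := bl_leZ a0 x0; rewrite scaler0. Qed.

Lemma bl_joinD x y z : bl_join (x + z) (y + z) = bl_join x y + z.
Proof.
apply: bl_le_anti.
  by apply/bl_leUx; split; apply/bl_leD2; [exact: bl_leUl|exact: bl_leUr].
apply/(bl_leD2 (- z)); rewrite addrK; apply/bl_leUx.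
by split; apply/(bl_leD2 z); rewrite subrK; [exact: bl_leUl|exact: bl_leUr].
Qed.

Definition pospart x : E := bl_join x 0.

Lemma pospart_ge0 x : 0 <=L pospart x. Proof. exact: bl_leUr. Qed.
Lemma pospart_ge x : x <=L pospart x. Proof. exact: bl_leUl. Qed.

Lemma pospartB x : pospart x - pospart (- x) = x.
Proof.
apply/eqP; rewrite subr_eq addrC /pospart -bl_joinD addNr add0r; apply/eqP.
by apply: bl_le_anti; apply/bl_leUx; split; (exact: bl_leUl || exact: bl_leUr).
Qed.

Lemma bl_le_modulus x : x <=L modulus x. Proof. exact: bl_leUl. Qed.
Lemma bl_leN_modulus x : - x <=L modulus x. Proof. exact: bl_leUr. Qed.

Lemma modulus_le x y : modulus x <=L y <-> - y <=L x /\ x <=L y.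
Proof.
rewrite bl_leUx -[- y <=L x]bl_leN2 opprK.
by split=> -[].
Qed.

Lemma modulus_ge0 x : 0 <=L modulus x.
Proof.
have h : 0 <=L modulus x + modulus x.
  rewrite -(subrr x).
  exact: (bl_leD (bl_le_modulus x) (bl_leN_modulus x)).
have i0 : (0 : R) <= 2^-1 by rewrite invr_ge0.
have e1 : 2^-1 + 2^-1 = 1 :> R by rewrite [RHS]splitr !mul1r.
by have := bl_scale_ge0 i0 h; rewrite scalerDr -scalerDl e1 scale1r.
Qed.

Lemma ge0_modulus x : 0 <=L x -> modulus x = x.
Proof.
move=> x0; apply: bl_le_anti; last exact: bl_le_modulus.
apply/modulus_le; split; last exact: bl_le_refl.
by apply: (bl_le_trans _ x0); rewrite -oppr0; apply/bl_leN2.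
Qed.

Lemma norm_le_modulus x y : modulus x <=L y -> `|x| <= `|y|.
Proof.
move=> xy; apply: bl_le_norm; rewrite -!/(modulus _) (ge0_modulus (x := y))//.
exact: bl_le_trans (modulus_ge0 x) xy.
Qed.

Lemma norm_modulus x : `|modulus x| = `|x|.
Proof.
apply/le_anti/andP; split; apply: bl_le_norm; rewrite -!/(modulus _).
  by rewrite ge0_modulus//; [exact: bl_le_refl|exact: modulus_ge0].
by rewrite [modulus (modulus x)]ge0_modulus//;
  [exact: bl_le_refl|exact: modulus_ge0].
Qed.

Lemma norm_bl_le x y : 0 <=L x -> x <=L y -> `|x| <= `|y|.
Proof. by move=> x0 xy; apply: norm_le_modulus; rewrite ge0_modulus. Qed.

Lemma norm_pospart x : `|pospart x| <= `|x|.
Proof.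
rewrite -(norm_modulus x) norm_bl_le//; first exact: pospart_ge0.
by apply/bl_leUx; split; [exact: bl_le_modulus|exact: modulus_ge0].
Qed.

Lemma pospartD_le x : pospart x + pospart (- x) <=L modulus x.
Proof.
rewrite {1}/pospart -bl_joinD add0r.
have /eqP := pospartB x; rewrite subr_eq => /eqP <-.
apply/bl_leUx; split; apply/bl_leUx; split; try exact: modulus_ge0.
  exact: bl_le_modulus.
exact: bl_leN_modulus.
Qed.

Lemma riesz_decomposition x y z :
  0 <=L x -> 0 <=L y -> 0 <=L z -> z <=L x + y ->
  exists u, [/\ 0 <=L u, u <=L x, 0 <=L z - u & z - u <=L y].
Proof.
move=> x0 y0 z0 zxy; exists (bl_meet z x); split.
- exact/bl_lexI.
- exact: bl_leIr.
- by apply/bl_subr_ge0; exact: bl_leIl.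
- apply/(bl_leD2 (bl_meet z x)); rewrite subrK.
  apply/(bl_leD2 (- y)); rewrite (addrC y) addrK; apply/bl_lexI; split.
    apply/(bl_leD2 y); rewrite subrK -[X in X <=L _]addr0.
    by apply: bl_leD => //; exact: bl_le_refl.
  by apply/(bl_leD2 y); rewrite subrK.
Qed.

End BanachLatticeTheory.

(******************************************************************************)
(* The dual of a Banach lattice, with its canonical order f <= g iff          *)
(* f x <= g x for all x >= 0 (Riesz-Kantorovich)                              *)
(******************************************************************************)

Section DualLattice.
Variables (R : realType) (E : banachLatticeType R).
Implicit Types (f g h : dual E) (x y z : E).

Definition dual_le f g := forall x, 0 <=L x -> f x <= g x.

(* the value at x >= 0 of the positive part of f *)
Definition rk f x : R := sup [set (f y : R) | y in [set y | 0 <=L y /\ y <=L x]].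

Lemma rk_has_sup f x : 0 <=L x ->
  has_sup [set (f y : R) | y in [set y | 0 <=L y /\ y <=L x]].
Proof.
move=> x0; split; first by exists (f 0), 0 => //=; split=> //; exact: bl_le_refl.
exists (`|f| * `|x|) => _ [y /= [y0 yx] <-].
by rewrite (le_trans (ler_norm _))// (le_trans (dual_ub _ _))// ler_wpM2l// norm_bl_le.
Qed.

Lemma rk_ub f x y : 0 <=L y -> y <=L x -> f y <= rk f x.
Proof.
move=> y0 yx; apply: (sup_upper_bound (rk_has_sup f (bl_le_trans y0 yx))).
by exists y.
Qed.

Lemma rk_le f x (M : R) : 0 <=L x ->
  (forall y, 0 <=L y -> y <=L x -> f y <= M) -> rk f x <= M.
Proof.
move=> x0 fM; apply: ge_sup; first by case: (rk_has_sup f x0).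
by move=> _ [y /= [y0 yx] <-]; exact: fM.
Qed.

Lemma rkD f x y : 0 <=L x -> 0 <=L y -> rk f (x + y) = rk f x + rk f y.
Proof.
move=> x0 y0; apply/le_anti/andP; split.
  apply: rk_le => [|z z0 zxy]; first exact: bl_addr_ge0.
  have [u [u0 ux v0 vy]] := riesz_decomposition x0 y0 z0 zxy.
  rewrite -(subrK u z) (linear_linD _ _ (@dual_linear _ _ f)) addrC.
  by rewrite lerD//; exact: rk_ub.
rewrite -lerBrDr; apply: rk_le => // u u0 ux.
rewrite lerBrDr addrC -lerBrDr; apply: rk_le => // v v0 vy.
rewrite lerBrDr -(linear_linD _ _ (@dual_linear _ _ f)); apply: rk_ub.
  exact: bl_addr_ge0.
by rewrite addrC; exact: bl_leD.
Qed.

Lemma rkZ f (a : R) x : 0 <= a -> 0 <=L x -> rk f (a *: x) = a * rk f x.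
Proof.
have le (b : R) z : 0 < b -> 0 <=L z -> rk f (b *: z) <= b * rk f z.
  move=> b0 z0; apply: rk_le => [|y y0 yz].
    by apply: bl_scale_ge0 => //; exact: ltW.
  have ib0 : 0 <= b^-1 by rewrite invr_ge0 ltW.
  rewrite -ler_pdivrMl//.
  have -> : b^-1 * f y = f (b^-1 *: y).
    by rewrite (linear_linZ _ _ (@dual_linear _ _ f)).
  apply: rk_ub; first exact: bl_scale_ge0.
  by have := bl_leZ ib0 yz; rewrite scalerA mulVf ?scale1r// gt_eqF.
rewrite le_eqVlt => /predU1P[<- x0|a0 x0].
  rewrite scale0r mul0r; apply/le_anti/andP; split.
    apply: rk_le => [|y y0 y0']; first exact: bl_le_refl.
    by rewrite (bl_le_anti y0' y0) (linear_lin0 (@dual_linear _ _ f)).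
  rewrite -[leLHS](linear_lin0 (@dual_linear _ _ f)).
  by apply: rk_ub; exact: bl_le_refl.
apply/le_anti; rewrite le//= -ler_pdivlMl//.
have /le : 0 < a^-1 by rewrite invr_gt0.
move=> /(_ (a *: x)); rewrite scalerA mulVf ?gt_eqF// scale1r; apply.
by apply: bl_scale_ge0 => //; exact: ltW.
Qed.

Lemma rk_ge0 f x : 0 <=L x -> 0 <= rk f x.
Proof.
move=> x0; rewrite -[leLHS](linear_lin0 (@dual_linear _ _ f)).
by apply: rk_ub => //; exact: bl_le_refl.
Qed.

Lemma rk_norm f x : 0 <=L x -> rk f x <= `|f| * `|x|.
Proof.
move=> x0; apply: rk_le => // y y0 yx.
by rewrite (le_trans (ler_norm _))// (le_trans (dual_ub _ _))// ler_wpM2l// norm_bl_le.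
Qed.

Definition rk_ext f x : R^o := rk f (pospart x) - rk f (pospart (- x)).

Lemma rk_extB f x y : 0 <=L x -> 0 <=L y -> rk_ext f (x - y) = rk f x - rk f y.
Proof.
move=> x0 y0; apply/eqP; rewrite /rk_ext subr_eq addrAC eq_sym subr_eq eq_sym.
have p0 := pospart_ge0 (x - y); have n0 := pospart_ge0 (- (x - y)).
rewrite -!rkD//; apply/eqP; congr (rk f _).
have /eqP := pospartB (x - y); rewrite subr_eq => /eqP ->.
by rewrite addrAC subrK addrC.
Qed.

Lemma rk_ext_pred f : rk_ext f \in @dual_pred R E.
Proof.
apply: (@dual_predP _ _ _ (`|f| + `|f|)) => [a x y|x]; last first.
  have p0 := pospart_ge0 x; have n0 := pospart_ge0 (- x).
  rewrite (le_trans (ler_normB _ _))// mulrDl lerD// ger0_norm ?rk_ge0//.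
    by rewrite (le_trans (rk_norm f p0))// ler_wpM2l// norm_pospart.
  by rewrite (le_trans (rk_norm f n0))// ler_wpM2l// -(normrN x) norm_pospart.
have xE := pospartB x; have yE := pospartB y.
have p0 := pospart_ge0 x; have n0 := pospart_ge0 (- x).
have q0 := pospart_ge0 y; have m0 := pospart_ge0 (- y).
have [a0|a0] := leP 0 a.
  have -> : a *: x + y = (a *: pospart x + pospart y) -
                         (a *: pospart (- x) + pospart (- y)).
    by rewrite opprD addrACA -scalerBr xE yE.
  rewrite rk_extB; try by apply: bl_addr_ge0 => //; apply: bl_scale_ge0.
  rewrite !rkD//; try by apply: bl_scale_ge0.
  rewrite !rkZ// /rk_ext scalerBr opprD addrACA.
  by [].
have b0 : 0 <= - a by rewrite oppr_ge0 ltW.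
have -> : a *: x + y = (- a *: pospart (- x) + pospart y) -
                       (- a *: pospart x + pospart (- y)).
  by rewrite opprD addrACA -scalerBr yE -[X in a *: X]xE -opprB scalerN scaleNr.
rewrite rk_extB; try by apply: bl_addr_ge0 => //; apply: bl_scale_ge0.
rewrite !rkD//; try by apply: bl_scale_ge0.
rewrite !rkZ// /rk_ext opprD addrACA; congr (_ + _).
by rewrite -mulrBr mulNr -mulrN opprB.
Qed.

Definition dual_pos f : dual E := Dual (rk_ext_pred f).

Lemma dual_posE f x : 0 <=L x -> dual_pos f x = rk f x.
Proof.
move=> x0; rewrite /dual_pos /= -[in LHS](subr0 x) rk_extB//; last exact: bl_le_refl.
have := rkZ f (lexx 0) x0; rewrite scale0r mul0r => ->.
by rewrite subr0.
Qed.

Definition dual_join f g : dual E := g + dual_pos (f - g).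
Definition dual_meet f g : dual E := f - dual_pos (f - g).

Lemma dual_le_refl f : dual_le f f. Proof. by []. Qed.

Lemma dual_le_anti f g : dual_le f g -> dual_le g f -> f = g.
Proof.
move=> fg gf; apply: dual_ext => x; rewrite -(pospartB x).
by rewrite !(linear_linB _ _ (@dual_linear _ _ _)); congr (_ - _);
  apply/le_anti/andP; split; (apply: fg || apply: gf); exact: pospart_ge0.
Qed.

Lemma dual_le_trans g f h : dual_le f g -> dual_le g h -> dual_le f h.
Proof. by move=> fg gh x x0; rewrite (le_trans (fg x x0))// gh. Qed.

Lemma dual_posP f h : dual_le (dual_pos f) h <-> dual_le f h /\ dual_le 0 h.
Proof.
split=> [fh|[fh h0] x x0].
  split=> x x0; apply: le_trans (fh x x0); rewrite dual_posE ?rk_ge0//.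
  by apply: rk_ub => //; exact: bl_le_refl.
rewrite dual_posE//; apply: rk_le => // y y0 yx; rewrite (le_trans (fh y y0))//.
rewrite -subr_ge0 -(linear_linB _ _ (@dual_linear _ _ h)).
by apply: h0; apply/bl_subr_ge0.
Qed.

Lemma dual_leUx f g h : dual_le (dual_join f g) h <-> dual_le f h /\ dual_le g h.
Proof.
have E1 k : dual_le (g + k) h <-> dual_le k (h - g).
  by split=> H x x0; have := H x x0; rewrite !dualDE dualNE lerBrDl.
rewrite E1 dual_posP -E1 addrC subrK; split=> -[fh gh]; split=> //.
  by rewrite -(addr0 g); apply/E1.
by apply/E1; rewrite addr0.
Qed.

Lemma dual_lexI f g h : dual_le f (dual_meet g h) <-> dual_le f g /\ dual_le f h.
Proof.
have E1 k : dual_le f (g - k) <-> dual_le k (g - f).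
  by split=> H x x0; have := H x x0; rewrite !dualDE !dualNE lerBrDl lerBrDr addrC.
rewrite E1 dual_posP -!E1 subr0 opprB addrC subrK.
by split=> -[].
Qed.

Lemma dual_leD2r h f g : dual_le f g -> dual_le (f + h) (g + h).
Proof. by move=> fg x x0; rewrite !dualDE lerD2r fg. Qed.

Lemma dual_leZ (a : R) f g : 0 <= a -> dual_le f g -> dual_le (a *: f) (a *: g).
Proof. by move=> a0 fg x x0; rewrite !dualZE ler_wpM2l// fg. Qed.

Lemma dual_le_norm f g :
  dual_le (dual_join f (- f)) (dual_join g (- g)) -> `|f| <= `|g|.
Proof.
move=> fg; apply: dual_norm_le => x x1.
have /dual_leUx[f1 f2] := dual_le_refl (dual_join f (- f)).
have p0 := pospart_ge0 x; have n0 := pospart_ge0 (- x).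
have m0 := modulus_ge0 x.
have H y : 0 <=L y -> `|f y| <= dual_join f (- f) y.
  move=> y0; have := f1 y y0; have := f2 y y0.
  by rewrite dualNE ler_norml lerNl => -> ->.
have fm : `|f x| <= dual_join f (- f) (modulus x).
  rewrite -[in leLHS](pospartB x) (linear_linB _ _ (@dual_linear _ _ f)).
  rewrite (le_trans (ler_normB _ _))//.
  rewrite (@le_trans _ _ (dual_join f (- f) (pospart x + pospart (- x))))//.
    by rewrite (linear_linD _ _ (@dual_linear _ _ _)) lerD// H.
  rewrite -subr_ge0 -(linear_linB _ _ (@dual_linear _ _ _)).
  by rewrite (le_trans _ (H _ _))//; apply/bl_subr_ge0; exact: pospartD_le.
rewrite (le_trans fm)// (le_trans (fg _ m0))//.
rewrite dualDE dualNE dual_posE// -lerBrDl opprK; apply: rk_le => // y y0 yx.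
rewrite opprK dualDE -lerBlDr.
have -> : g y + g y - g (modulus x) = g (y + y - modulus x).
  by rewrite (linear_linB _ _ (@dual_linear _ _ g)) (linear_linD _ _ (@dual_linear _ _ g)).
rewrite (le_trans (ler_norm _))// (le_trans (dual_ub _ _))//.
rewrite -[leRHS]mulr1 ler_wpM2l// (le_trans _ x1)//.
rewrite -(norm_modulus x); apply: norm_le_modulus; apply/modulus_le; split.
  rewrite -[X in X <=L _]add0r; apply/bl_leD2; exact: bl_addr_ge0.
by apply/(bl_leD2 (modulus x)); rewrite subrK; exact: bl_leD.
Qed.

HB.instance Definition _ := isBanachLattice.Build R (dual E)
  dual_le_refl dual_le_anti dual_le_trans dual_lexI dual_leUx
  dual_leD2r dual_leZ dual_le_norm.

End DualLattice.

(******************************************************************************)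
(* Continuous multilinear maps                                                *)
(******************************************************************************)

Section Multilinear.
Variables (R : realType) (I : finType) (E : I -> normedModType R).
Variable (G : normedModType R).

Definition multilinear (A : (forall i, E i) -> G) :=
  forall i (x : forall j, E j), linear (fun t : E i => A (dfwith x i t)).

(* prod_topology is the product of the norm topologies *)
Record mlinear := MLinear {
  mlin_fun :> (forall i, E i) -> G ;
  mlinP : multilinear mlin_fun ;
  mlin_cts : continuous (mlin_fun : prod_topology E -> G) }.

Implicit Types (A : (forall i, E i) -> G) (x y : forall i, E i).

Definition unit_bounded A (M : R) :=
  forall x, (forall i, `|x i| <= 1) -> `|A x| <= M.

Lemma dfwith_id x i : dfwith x i (x i) = x.
Proof. by apply: functional_extensionality_dep => j; case: dfwithP. Qed.

Lemma mlin_scale A (c : R) x : multilinear A ->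
  A (fun i => c *: x i) = c ^+ #|I| *: A x.
Proof.
move=> Am; pose y (s : seq I) := fun i => if i \in s then c *: x i else x i.
have H s : uniq s -> A (y s) = c ^+ size s *: A x.
  elim: s => [|j s IH] /=; first by rewrite expr0 scale1r.
  move=> /andP[js us]; rewrite exprS -scalerA -IH//.
  have -> : y (j :: s) = dfwith (y s) j (c *: x j).
    apply: functional_extensionality_dep => i; case: dfwithP => [|i' ji'].
      by rewrite /y mem_head.
    by rewrite /y in_cons eq_sym (negPf ji').
  rewrite (linear_linZ _ _ (Am j (y s))); congr (_ *: A _).
  have {1}-> : x j = y s j by rewrite /y (negPf js).
  exact: dfwith_id.
rewrite cardE -H ?enum_uniq//; congr (A _).
by apply: functional_extensionality_dep => i; rewrite /y mem_enum.
Qed.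

Lemma mlin_bounded (A : mlinear) : exists2 M, 0 <= M & unit_bounded A M.
Proof.
pose F : set_system (prod_topology E) :=
  filter_from [set e : R | 0 < e] (fun e => [set x | forall i, `|x i| < e]).
have FF : Filter F.
  apply: filter_from_filter; first by exists 1 => /=.
  move=> d e /= d0 e0; exists (Num.min d e); first by rewrite /= lt_min d0 e0.
  by move=> x /= xde; split=> i; have := xde i; rewrite lt_min => /andP[].
pose p0 : prod_topology E := fun=> 0.
have F0 : F --> p0.
  apply/cvg_sup => i U [V [[W oW WV] V0] VU]; rewrite -WV in V0 VU.
  have : nbhs (0 : E i) W by apply: open_nbhs_nbhs; split.
  move=> /nbhs_norm0P[e /= e0 eW]; exists e => // x /= xe; apply: VU => /=.
  exact/eW/xe.
have := @mlin_cts A p0 _ (nbhsx_ballx _ _ ltr01) => /F0[e /= e0 eA].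
pose c := e / 2; have c0 : 0 < c by rewrite divr_gt0.
exists (c ^- #|I| * (`|A p0| + 1)).
  by apply: mulr_ge0; [rewrite invr_ge0 exprn_ge0// ltW|exact: addr_ge0].
move=> x x1; rewrite ler_pdivlMl ?exprn_gt0//.
rewrite -[X in X * _]ger0_norm ?exprn_ge0 ?(ltW c0)// -normrZ -mlin_scale//; last exact: mlinP.
have /eA : forall i, `|c *: x i| < e.
  move=> i; rewrite normrZ (gtr0_norm c0).
  apply: (@le_lt_trans _ _ (c * 1)); last by rewrite mulr1 gtr_pMr// invf_lt1// ltr1n.
  by apply: ler_wpM2l; [exact: ltW|exact: x1].
rewrite /= -ball_normE /= distrC => /ltW h.
by rewrite -lerBlDl (le_trans (lerB_dist _ _)).
Qed.

Lemma unit_bounded_scale A (M r : R) x : multilinear A -> unit_bounded A M ->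
  0 < r -> (forall i, `|x i| <= r) -> `|A x| <= r ^+ #|I| * M.
Proof.
move=> Am AM r0 xr.
have -> : x = fun i => r *: (r^-1 *: x i).
  apply: functional_extensionality_dep => i.
  by rewrite scalerA divff ?gt_eqF// scale1r.
rewrite mlin_scale// normrZ ger0_norm ?exprn_ge0 ?(ltW r0)//.
rewrite ler_wpM2l ?exprn_ge0 ?(ltW r0)// AM// => i.
by rewrite normrZ gtr0_norm ?invr_gt0// ler_pdivrMl// mulr1 xr.
Qed.

Lemma unit_bounded_cts A (M : R) : multilinear A -> unit_bounded A M ->
  continuous (A : prod_topology E -> G).
Proof.
move=> Am AM a.
have FF : Filter (nbhs (a : prod_topology E)) by exact: nbhs_filter.
apply/(@cvgrPdist_le _ _ _ (nbhs (a : prod_topology E)) FF) => e e0.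
have M0 : 0 <= M.
  by rewrite (le_trans _ (AM (fun=> 0) _))// => i; rewrite normr0.
pose r := 1 + \sum_i `|a i|; have r1 : 1 <= r by rewrite lerDl sumr_ge0.
have r0 : 0 < r by rewrite (lt_le_trans ltr01).
have ar i : `|a i| + 1 <= r.
  by rewrite addrC lerD2l (bigD1 i)//= lerDl sumr_ge0.
pose K := #|I|%:R * (r ^+ #|I| * M) + 1.
have K0 : 0 < K by rewrite ltr_wpDl// mulr_ge0// mulr_ge0// exprn_ge0// ltW.
pose d := Num.min 1 (e / K).
have d0 : 0 < d by rewrite lt_min ltr01 divr_gt0.
have : \forall x \near (a : prod_topology E), forall i, `|a i - x i| < d.
  apply: (@filter_forall _ _ (fun i (x : prod_topology E) => `|a i - x i| < d) _ FF) => i.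
  apply: (@filterS _ _ FF _ _ _ (@proj_continuous I E i a _ (nbhsx_ballx _ _ d0))).
  by move=> x /=; rewrite -ball_normE.
apply: (@filterS _ _ FF) => x xa.
have xr i : `|x i| <= r.
  rewrite (le_trans _ (ar i))// -[x i](subrK (a i)) addrC (le_trans (ler_normD _ _))//.
  rewrite lerD2l distrC (le_trans (ltW (xa i)))//.
  by rewrite /d ge_min lexx.
pose y (s : seq I) := fun i => if i \in s then x i else a i.
have yr s i : `|y s i| <= r.
  by rewrite /y; case: ifP => // _; rewrite (le_trans _ (ar i))// lerDl.
have H s : uniq s -> `|A a - A (y s)| <= (size s)%:R * (d * (r ^+ #|I| * M)).
  elim: s => [|j s IH] /=; first by rewrite subrr normr0 mul0r.
  move=> /andP[js us]; rewrite -(subrKA (A (y s))) (le_trans (ler_normD _ _))//.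
  rewrite -natr1 mulrDl mul1r lerD ?IH//.
  have -> : y (j :: s) = dfwith (y s) j (x j).
    apply: functional_extensionality_dep => i; case: dfwithP => [|i' ji'].
      by rewrite /y mem_head.
    by rewrite /y in_cons eq_sym (negPf ji').
  have -> : A (y s) = A (dfwith (y s) j (a j)).
    have {1}-> : a j = y s j by rewrite /y (negPf js).
    by rewrite dfwith_id.
  rewrite -(linear_linB _ _ (Am j (y s))).
  have -> : a j - x j = d *: (d^-1 *: (a j - x j)).
    by rewrite scalerA divff ?gt_eqF// scale1r.
  rewrite (linear_linZ _ _ (Am j (y s))) normrZ (gtr0_norm d0).
  rewrite ler_wpM2l ?(ltW d0)// (unit_bounded_scale (r := r))// => i.
  case: dfwithP => // {i}.
  rewrite normrZ gtr0_norm ?invr_gt0// (le_trans _ r1)//.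
  by rewrite ler_pdivrMl// mulr1 (ltW (xa _)).
have := H _ (enum_uniq I); rewrite -cardE.
have -> : y (enum I) = x.
  by apply: functional_extensionality_dep => i; rewrite /y mem_enum.
move/le_trans; apply; rewrite mulrCA.
apply: (@le_trans _ _ (e / K * K)); last by rewrite divfK// gt_eqF.
apply: ler_pM; rewrite ?(ltW d0)//.
- by rewrite mulr_ge0// mulr_ge0// exprn_ge0// ltW.
- by rewrite /d ge_min lexx orbT.
- by rewrite /K lerDl.
Qed.

End Multilinear.

(******************************************************************************)
(* Aron-Berner extensions                                                     *)
(******************************************************************************)

Section AronBerner.
Variables (R : realType) (m : nat) (E : 'I_m -> normedModType R).
Variables (F : normedModType R) (rho : 'S_m).

(* Indices are counted from 0: i is not one of rho 0, ..., rho (k - 1) if and *)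
(* only if k <= rho^-1 i.                                                      *)
Definition ab_index (k : nat) := {i : 'I_m | (k <= (rho^-1)%g i)%N}.

Definition ab_space (k : nat) :=
  mlinear (fun i : ab_index k => E (val i)) R^o.

Definition ab_zext k (x : forall i : ab_index k, E (val i)) (i : 'I_m) : E i :=
  if @idP (k <= (rho^-1)%g i)%N is ReflectT h then x (exist _ i h) else 0.

(* the point of \prod_(i : ab_index k) E i with coordinate t at rho k and with *)
(* the coordinates of x elsewhere                                              *)
Definition ab_insert (k : 'I_m) (x : forall i : ab_index k.+1, E (val i))
    (t : E (rho k)) : forall i : ab_index k, E (val i) :=
  fun i => dfwith (ab_zext x) (rho k) t (val i).

Lemma ab_zextE k (x : forall i : ab_index k, E (val i)) i :
  ab_zext x (val i) = x i.
Proof.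
case: i => i h; rewrite /ab_zext /=; case: {-}_ / idP => [h'|//].
by rewrite (bool_irrelevance h' h).
Qed.

Lemma ab_pivot_subproof (k : 'I_m) : (k <= (rho^-1)%g (rho k))%N.
Proof. by rewrite permK. Qed.

Definition ab_pivot (k : 'I_m) : ab_index k :=
  exist _ (rho k) (ab_pivot_subproof k).

Definition ab_weak k (i : ab_index k.+1) : ab_index k :=
  exist _ (val i) (ltnW (valP i)).

Lemma ab_insert_pivot (k : 'I_m) (x : forall i : ab_index k.+1, E (val i)) t :
  ab_insert x t =
  @dfwith _ (fun i : ab_index k => E (val i)) (ab_insert x 0) (ab_pivot k) t.
Proof.
apply: functional_extensionality_dep => i; case: dfwithP => [|j kj].
  by rewrite /ab_insert /= dfwithin.
have kj' : rho k != val j by apply: contra kj => /eqP kj; apply/eqP/val_inj.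
by rewrite /ab_insert !dfwithout.
Qed.

Lemma ab_insert_weak (k : 'I_m) (x : forall i : ab_index k.+1, E (val i)) t
    (i : ab_index k.+1) (u : E (val i)) :
  ab_insert (dfwith x i u) t =
  @dfwith _ (fun i : ab_index k => E (val i)) (ab_insert x t) (ab_weak i) u.
Proof.
have ki : rho k != val i.
  by apply/eqP => ki; have := valP i; rewrite /= -ki permK ltnn.
apply: functional_extensionality_dep => l; case: dfwithP => [|j ij].
  by rewrite /ab_insert /= dfwithout// ab_zextE dfwithin.
have ij' : val i != val j by apply: contra ij => /eqP ij; apply/eqP/val_inj.
rewrite /ab_insert /dfwith; case: eqP => // _.
rewrite /ab_zext; case: {-}_ / idP => // h.
by rewrite -/(dfwith x i u _) dfwithout.
Qed.

Lemma ab_free_subproof (k : 'I_m) (B : ab_space k)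
    (x : forall i : ab_index k.+1, E (val i)) :
  (fun t : E (rho k) => B (ab_insert x t)) \in @dual_pred R (E (rho k)).
Proof.
have -> : (fun t : E (rho k) => B (ab_insert x t)) =
          (fun t : E (val (ab_pivot k)) => B (dfwith (ab_insert x 0) (ab_pivot k) t)).
  by apply/funext => t; rewrite ab_insert_pivot.
apply/asboolP; split; first exact: mlinP.
move=> t; apply: (@continuous_comp _
    (prod_topology (fun i : ab_index k => E (val i))) _
    (@dfwith _ (fun i : ab_index k => E (val i)) (ab_insert x 0) (ab_pivot k)) B).
  exact: (@dfwith_continuous _ (fun i : ab_index k => E (val i))).
exact: mlin_cts.
Qed.

(* the functional on E (rho k) left by B once the other variables are fixed    *)
Definition ab_free (k : 'I_m) (B : ab_space k)
    (x : forall i : ab_index k.+1, E (val i)) : dual (E (rho k)) :=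
  Dual (ab_free_subproof B x).

Lemma ab_free_unit (k : 'I_m) (B : ab_space k) (M : R) x :
  unit_bounded B M -> (forall i, `|x i| <= 1) -> `|ab_free B x| <= M.
Proof.
move=> BM x1; apply: dual_norm_le => t t1; apply: BM => i.
rewrite /ab_insert; case: dfwithP => // j kj.
by rewrite /ab_zext; case: {-}_ / idP => [h|_]; [exact: x1|rewrite normr0].
Qed.

Lemma ab_step_mlin (k : 'I_m) (z : dual (dual (E (rho k)))) (B : ab_space k) :
  multilinear (fun x => z (ab_free B x)).
Proof.
move=> i x a u v; rewrite -(@dual_linear _ _ z); congr (z _).
apply: dual_ext => t; rewrite dualDE dualZE /= !ab_insert_weak.
exact: (@mlinP _ _ _ _ B).
Qed.

Lemma ab_step_unit (k : 'I_m) (z : dual (dual (E (rho k)))) (B : ab_space k) M :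
  unit_bounded B M -> unit_bounded (fun x => z (ab_free B x)) (`|z| * M).
Proof.
move=> BM x x1; rewrite (le_trans (dual_ub _ _))// ler_wpM2l//.
exact: ab_free_unit.
Qed.

Lemma ab_step_cts (k : 'I_m) (z : dual (dual (E (rho k)))) (B : ab_space k) :
  continuous ((fun x => z (ab_free B x)) :
    prod_topology (fun i : ab_index k.+1 => E (val i)) -> R^o).
Proof.
have [M M0 BM] := mlin_bounded B.
exact: unit_bounded_cts (ab_step_mlin z B) (@ab_step_unit k z B M BM).
Qed.

(* the extension of x**_rho(k) as an operator from ab_space k to ab_space k.+1 *)
Definition ab_step (k : 'I_m) (z : dual (dual (E (rho k)))) (B : ab_space k) :
  ab_space k.+1 := MLinear (ab_step_mlin z B) (@ab_step_cts k z B).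

Fixpoint ab_comp (x : forall i, dual (dual (E i))) (k : nat) :
    (k <= m)%N -> ab_space 0 -> ab_space k :=
  if k is k'.+1 then
    fun lt_k'm B => ab_step (x (rho (Ordinal lt_k'm))) (ab_comp x (ltnW lt_k'm) B)
  else fun _ B => B.

(* ab_index 0 is 'I_m, up to the trivial inequality 0 <= rho^-1 i *)
Definition ab_full (x : forall i : ab_index 0, E (val i)) (i : 'I_m) : E i :=
  x (exist _ i (leq0n _)).

Lemma ab_start_mlin (f : dual F) (A : mlinear E F) :
  multilinear (fun x => f (A (ab_full x)) : R^o).
Proof.
have fullE (x : forall i : ab_index 0, E (val i)) i (t : E (val i)) :
    ab_full (dfwith x i t) = dfwith (ab_full x) (val i) t.
  apply: functional_extensionality_dep => j; case: dfwithP => [|l il].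
    rewrite /ab_full; move: t; case: i => i h t /=.
    by rewrite (bool_irrelevance (leq0n _) h) dfwithin.
  by rewrite /ab_full dfwithout//; apply: contra il => /eqP ->.
move=> i x a u v; rewrite !fullE (@mlinP _ _ _ _ A).
exact: dual_linear.
Qed.

Lemma ab_start_unit (f : dual F) (A : mlinear E F) M : unit_bounded A M ->
  unit_bounded (fun x => f (A (ab_full x)) : R^o) (`|f| * M).
Proof.
move=> AM x x1; rewrite (le_trans (dual_ub _ _))// ler_wpM2l// AM// => i.
exact: x1.
Qed.

Lemma ab_start_cts (f : dual F) (A : mlinear E F) :
  continuous ((fun x => f (A (ab_full x))) :
    prod_topology (fun i : ab_index 0 => E (val i)) -> R^o).
Proof.
have [M M0 AM] := mlin_bounded A.
exact: unit_bounded_cts (ab_start_mlin f A) (ab_start_unit f AM).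
Qed.

Definition ab_start (f : dual F) (A : mlinear E F) : ab_space 0 :=
  MLinear (ab_start_mlin f A) (@ab_start_cts f A).

(* ab_index m is empty, so a form in ab_space m is a real number: its value at *)
(* the only point of the empty product                                         *)
Definition ab_eval (A : mlinear E F) (x : forall i, dual (dual (E i)))
    (f : dual F) : R^o :=
  ab_comp x (leqnn m) (ab_start f A) (fun=> 0).

Lemma ab_comp_lin x k (h : (k <= m)%N) (B B1 B2 : ab_space 0) (a : R) :
  (forall y, B y = a *: B1 y + B2 y) ->
  forall y, ab_comp x h B y = a *: ab_comp x h B1 y + ab_comp x h B2 y.
Proof.
move=> BE; elim: k h => [|k IH] h //= y.
rewrite -(@dual_linear _ _ (x _)); congr (x _ _); apply: dual_ext => t.
by rewrite dualDE dualZE /= IH.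
Qed.

Lemma ab_comp_unit x k (h : (k <= m)%N) : exists C : R,
  forall (B : ab_space 0) M, unit_bounded B M -> unit_bounded (ab_comp x h B) (C * M).
Proof.
elim: k h => [|k IH] h /=; first by exists 1 => B M BM; rewrite mul1r.
have [C CP] := IH (ltnW h); exists (`|x (rho (Ordinal h))| * C) => B M BM.
by rewrite -mulrA; exact: (@ab_step_unit (Ordinal h) _ _ _ (CP _ _ BM)).
Qed.

Lemma ab_eval_dual (A : mlinear E F) x : ab_eval A x \in @dual_pred R (dual F).
Proof.
have [C CP] := ab_comp_unit x (leqnn m).
have [M M0 AM] := mlin_bounded A.
apply: (@dual_predP _ _ _ (C * M)) => [a f g|f].
  by apply: ab_comp_lin => y.
rewrite -mulrA (mulrC M).
apply: (CP (ab_start f A) _ (@ab_start_unit f A M AM)) => i.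
by rewrite normr0.
Qed.

Definition aron_berner (A : mlinear E F) (x : forall i, dual (dual (E i))) :
  dual (dual F) := Dual (ab_eval_dual A x).

End AronBerner.

(******************************************************************************)
(* Finite rank and almost Dunford-Pettis operators                            *)
(******************************************************************************)

Section FiniteRank.
Variables (R : realType) (V : lmodType R).

Definition lin_span (S : set V) : set V :=
  [set v | exists n (a : 'I_n -> R) (s : 'I_n -> V),
    (forall i, S (s i)) /\ v = \sum_i a i *: s i].

Definition finite_dim (W : set V) :=
  exists n (b : 'I_n -> V), W = lin_span (range b).

Definition finite_rank (T : Type) (A : T -> V) := finite_dim (lin_span (range A)).

End FiniteRank.

Section AlmostDunfordPettis.
Variables (R : realType) (G : completeNormedModType R).

Definition disjoint_seq (E : banachLatticeType R) (x : nat -> E) :=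
  forall n k, n <> k -> bl_meet (modulus (x n)) (modulus (x k)) = 0.

Definition weakly_null (E : normedModType R) (x : nat -> E) :=
  forall f : dual E, f (x n) @[n --> \oo] --> (0 : R^o).

Definition almost_DP (E : banachLatticeType R) (T : E -> G) :=
  [/\ linear T, continuous T &
    forall x : nat -> E, disjoint_seq x -> weakly_null x ->
      T (x n) @[n --> \oo] --> (0 : G)].

Definition separately_almost_DP (I : finType) (E : I -> banachLatticeType R)
    (A : (forall i, E i) -> G) :=
  forall j (x : forall i, E i), almost_DP (fun t : E j => A (dfwith x j t)).

End AlmostDunfordPettis.

(* Main.v *)
(** If b_1, ..., b_n span the range of A, then AB(A)(x) vanishes at every f in
    G* with f(b_1) = ... = f(b_n) = 0, because then f o A = 0.  There are f_l in
    G* and psi_l in G** such that f - sum_l psi_l(f) f_l always kills all the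
    b_i, so AB(A)(x) = sum_l AB(A)(x)(f_l) psi_l for all x, which gives finite
    rank.  When all coordinates of x but one are fixed, each coefficient
    AB(A)(x)(f_l) is a continuous linear form in the remaining one, so it tends
    to 0 along every weakly null sequence, disjoint or not. *)

Require Import Defs.
From mathcomp Require Import all_boot all_order all_algebra all_fingroup.
From mathcomp Require Import mathcomp_extra boolp classical_sets functions reals.
From mathcomp Require Import topology normedtype sequences.

Set Implicit Arguments.
Unset Strict Implicit.
Unset Printing Implicit Defensive.

Import Order.TTheory GRing.Theory Num.Theory.
Import numFieldNormedType.Exports.

Local Open Scope classical_set_scope.
Local Open Scope ring_scope.

(** * Linear spans and subspaces of finite-dimensional spaces *)

Section LinSpan.
Variables (R : realType) (V : lmodType R).
Implicit Types (S W : set V).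

Definition is_subspace W := W 0 /\ forall (a : R) u v, W u -> W v -> W (a *: u + v).

Lemma subspace_sum W n (a : 'I_n -> R) (s : 'I_n -> V) :
  is_subspace W -> (forall i, W (s i)) -> W (\sum_i a i *: s i).
Proof.
move=> [W0 WD] Ws; elim/big_ind: _ => // [u v Wu Wv|i _].
  by rewrite -[u]scale1r; exact: WD.
by rewrite -[_ *: _]addr0; exact: WD.
Qed.

Lemma sub_lin_span S : S `<=` lin_span S.
Proof.
move=> v Sv; exists 1%N, (fun=> 1), (fun=> v).
by split=> //; rewrite big_ord1 scale1r.
Qed.

Lemma lin_span_min S W : is_subspace W -> S `<=` W -> lin_span S `<=` W.
Proof. by move=> Wsub SW _ [n [a [s [Ss ->]]]]; apply: subspace_sum => // i; exact: SW. Qed.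

Lemma lin_span_subspace S : is_subspace (lin_span S).
Proof.
split; first by exists 0%N, (fun=> 0), (fun=> 0); split; [case|rewrite big_ord0].
move=> c _ _ [n [a [s [Ss ->]]]] [p [b [t [St ->]]]].
exists (n + p)%N,
  (fun i => match fintype.split i with inl j => c * a j | inr k => b k end),
  (fun i => match fintype.split i with inl j => s j | inr k => t k end).
split=> [i|]; first by case: (fintype.split i).
rewrite big_split_ord /= scaler_sumr; congr (_ + _); apply: eq_bigr => i _.
  by rewrite (unsplitK (inl i)) scalerA.
by rewrite (unsplitK (inr i)).
Qed.

(** Collects coefficients: a combination in [lin_span] may repeat generators, whereas the row [a]
    has one entry per index. *)
Lemma lin_span_rangeP n (c : 'I_n -> V) v :
  lin_span (range c) v <-> exists a : 'rV[R]_n, v = \sum_i a 0 i *: c i.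
Proof.
split=> [|[a ->]]; last first.
  apply: subspace_sum (lin_span_subspace _) _ => i.
  by apply: sub_lin_span; exists i.
pose W := [set v | exists a : 'rV[R]_n, v = \sum_i a 0 i *: c i].
suff : lin_span (range c) `<=` W by exact.
apply: lin_span_min => [|_ [i _ <-]]; last first.
  exists (delta_mx 0 i); rewrite (bigD1 i)//= mxE !eqxx scale1r big1 ?addr0// => j ji.
  by rewrite mxE (negPf ji) andbF scale0r.
split; first by exists 0; rewrite big1// => i _; rewrite mxE scale0r.
move=> x _ _ [a ->] [b ->]; exists (x *: a + b).
rewrite scaler_sumr -big_split /=; apply: eq_bigr => i _.
by rewrite !mxE scalerDl scalerA.
Qed.

(* The rows of a matrix of maximal rank among those whose rows are coordinates *)
(* of vectors of W span all the coordinates of vectors of W.                   *)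
Lemma subspace_finite_dim n (c : 'I_n -> V) W :
  is_subspace W -> W `<=` lin_span (range c) -> finite_dim W.
Proof.
move=> Wsub Wc; have [W0 WD] := Wsub.
pose L (a : 'rV[R]_n) := \sum_i a 0 i *: c i.
have LD x a b : L (x *: a + b) = x *: L a + L b.
  rewrite /L scaler_sumr -big_split /=; apply: eq_bigr => i _.
  by rewrite !mxE scalerDl scalerA.
have L0 : L 0 = 0 by rewrite /L big1// => i _; rewrite mxE scale0r.
have LM (u : 'rV[R]_n) (M : 'M[R]_n) : L (u *m M) = \sum_i u 0 i *: L (row i M).
  rewrite mulmx_sum_row; elim/big_rec2: _ => [//|i y z _ <-].
  by rewrite LD.
pose P r := `[< exists2 M : 'M[R]_n, forall i, W (L (row i M)) & \rank M = r >].
have P0 : exists r, P r.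
  exists 0%N; apply/asboolP; exists 0; last by rewrite mxrank0.
  by move=> i; rewrite linear0 L0.
have Pn r : P r -> (r <= n)%N by move=> /asboolP[M _ <-]; exact: rank_leq_row.
case: (ex_maxnP P0 Pn) => r /asboolP[M MW Mr] rmax.
exists n, (fun i => L (row i M)); apply/seteqP; split; last first.
  by apply: lin_span_min => // _ [i _ <-].
move=> v Wv; have /lin_span_rangeP[a va] := Wc _ Wv.
suff /submxP[u au] : (a <= M)%MS.
  by apply/lin_span_rangeP; exists u; rewrite -LM -au.
(* [(M + a)%MS] is again an n by n matrix. Its rows combine rows of [M] with [a], so their images
   under [L] stay in [W], and maximality of [r] bounds its rank. *)
suff : (\rank (M + a)%MS <= \rank M)%N.
  rewrite (geq_leqif (mxrank_leqif_sup (addsmxSl M a))).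
  by apply: submx_trans; exact: addsmxSr.
rewrite Mr; apply: rmax; apply/asboolP; exists (M + a)%MS => // i.
have /sub_addsmxP[[u w] /= ->] := row_sub i (M + a)%MS.
rewrite -[u *m M]scale1r LD scale1r LM.
rewrite (mx11_scalar w) mul_scalar_mx -[_ *: a]addr0 LD L0 addr0.
rewrite addrC; apply: WD; first by rewrite /L -va.
exact: subspace_sum.
Qed.

End LinSpan.

(** Serves twice: with a neighbourhood filter for continuity, and with [\oo] for convergence along a
    sequence. *)
Lemma cvg_sumZr (R : realType) (W : normedModType R) (T : Type) (F : set_system T)
    {FF : Filter F} n (g : 'I_n -> T -> R^o) (c : 'I_n -> R^o) (w : 'I_n -> W) :
  (forall i, g i t @[t --> F] --> c i) ->
  \sum_i g i t *: w i @[t --> F] --> \sum_i c i *: w i.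
Proof.
by move=> gc; apply: cvg_big => [|i _]; [exact: add_continuous|exact: cvgZr_tmp].
Qed.

(** * Common kernels of finitely many functionals *)

Section DualTheory.
Variables (R : realType) (V : normedModType R).

Lemma dual_sumr (f : dual V) n (a : 'I_n -> R) (s : 'I_n -> V) :
  f (\sum_i a i *: s i) = \sum_i a i * f (s i).
Proof.
rewrite -[LHS]/(lin_pack (@dual_linear _ _ f) _) linear_sum.
by apply: eq_bigr => i _; rewrite linearZ.
Qed.

Lemma dual_suml n (a : 'I_n -> R) (f : 'I_n -> dual V) u :
  (\sum_i a i *: f i) u = \sum_i a i * f i u.
Proof.
by elim/big_rec2: _ => [//|i y z _ <-]; rewrite dualDE dualZE.
Qed.

Lemma bidual_eval_pred (u : V) : (fun f : dual V => f u : R^o) \in @dual_pred R (dual V).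
Proof.
by apply: (@dual_predP _ _ _ `|u|) => // f; rewrite mulrC; exact: dual_ub.
Qed.

Definition bidual_eval (u : V) : dual (dual V) := Dual (bidual_eval_pred u).

(** Induction on [n]: if [phi ord0] vanishes on the common kernel of the others, their projection
    still works; otherwise it is corrected along some [w] in that kernel with [phi ord0 w != 0]. *)
Lemma dual_common_kernel_proj n (phi : 'I_n -> dual V) :
  exists k (v : 'I_k -> V) (psi : 'I_k -> dual V),
    forall u i, phi i (u - \sum_l psi l u *: v l) = 0.
Proof.
elim: n phi => [|n IH] phi; first by exists 0%N, (fun=> 0), (fun=> 0) => u [].
have [k [v [psi vP]]] := IH (fun i => phi (lift ord0 i)).
have [[w w0 pw]|nw] := pselect (exists2 w, forall i, phi (lift ord0 i) w = 0 &
                                   phi ord0 w != 0); last first.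
  exists k, v, psi => u i; case: (unliftP ord0 i) => [j ->|->]; first exact: vP.
  by apply: contrapT => /eqP h; apply: nw; exists (u - \sum_l psi l u *: v l).
(* [t u] is the multiple of [w] to subtract from [u - \sum_l psi l u *: v l] so that [phi ord0]
   vanishes on the result. *)
pose t : dual V := (phi ord0 w)^-1 *: (phi ord0 - \sum_l phi ord0 (v l) *: psi l).
exists k.+1, (fun l => if unlift ord0 l is Some j then v j else w),
  (fun l => if unlift ord0 l is Some j then psi j else t) => u i.
rewrite big_ord_recl unlift_none (eq_bigr (fun l => psi l u *: v l)); last first.
  by move=> l _; rewrite liftK.
rewrite opprD addrCA addrC (linear_linB _ _ (@dual_linear _ _ _)).
rewrite (linear_linZ _ _ (@dual_linear _ _ _)).
case: (unliftP ord0 i) => [j ->|->]; first by rewrite vP w0 scaler0 subrr.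
rewrite [t u]dualZE dualBE dual_suml (linear_linB _ _ (@dual_linear _ _ _)) dual_sumr.
rewrite [_ *: _]mulrAC mulVf// mul1r.
under [in X in _ - (_ - X)]eq_bigr do rewrite mulrC.
by rewrite subrr.
Qed.

End DualTheory.

(** * Dependence of the Aron-Berner extension on the form and on one variable *)

Section AronBernerTheory.
Variables (R : realType) (m : nat) (E : 'I_m -> normedModType R).
Variables (F : normedModType R) (rho : 'S_m).

Lemma ab_comp_eq0 (x : forall i, dual (dual (E i))) k (h : (k <= m)%N) (B : ab_space E rho 0) :
  (forall y, B y = 0) -> forall y, ab_comp x h B y = 0.
Proof.
move=> B0 y; have BE z : B z = -1 *: B z + B z by rewrite B0 scaler0 addr0.
by rewrite (ab_comp_lin x h BE) scaleN1r addNr.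
Qed.

Lemma aron_berner_eq0 (A : mlinear E F) x (f : dual F) :
  (forall y, f (A y) = 0) -> aron_berner rho A x f = 0.
Proof. by move=> fA; apply: ab_comp_eq0 => y; exact: fA. Qed.

(** The first [k] steps read only the coordinates [rho 0], ..., [rho (k - 1)], and [j] is not among
    them. *)
Lemma ab_comp_dfwith (x : forall i, dual (dual (E i))) j t k (h : (k <= m)%N)
    (B : ab_space E rho 0) :
  (k <= (rho^-1)%g j)%N ->
  forall y, ab_comp (dfwith x j t) h B y = ab_comp x h B y.
Proof.
elim: k h => [//|k IH] h kj y /=.
have jk : j != rho (Ordinal h).
  by apply: contraTneq kj => ->; rewrite permK /= ltnn.
rewrite dfwithout//; congr (x _ _); apply: dual_ext => u /=.
exact/IH/ltnW.
Qed.

(** The variable [t] enters exactly at step [rho^-1 j], where it is applied to functionals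
    independent of [t]. Each later step applies a fixed bidual element, which preserves linearity
    and multiplies the bound by its norm. *)
Lemma ab_comp_linear_bounded (x : forall i, dual (dual (E i))) j k (h : (k <= m)%N)
    (B : ab_space E rho 0) :
  ((rho^-1)%g j < k)%N ->
  (forall y, linear (fun t => ab_comp (dfwith x j t) h B y)) /\
  exists C : R, forall t, unit_bounded (ab_comp (dfwith x j t) h B) (C * `|t|).
Proof.
elim: k h => [//|k IH] h; rewrite ltnS leq_eqVlt => /predU1P[jk|jk].
  have {}jk : j = rho (Ordinal h) by rewrite -[LHS](permKV rho); congr (rho _); exact: val_inj.
  subst j.
  have stepE t y : ab_comp (dfwith x (rho (Ordinal h)) t) h B y =
                   t (@ab_free _ _ _ _ (Ordinal h) (ab_comp x (ltnW h) B) y).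
    rewrite /= dfwithin; congr (t _); apply: dual_ext => u /=.
    by apply: ab_comp_dfwith; rewrite permK.
  split=> [y a t1 t2|]; first by rewrite !stepE.
  have [M M0 BM] := mlin_bounded (ab_comp x (ltnW h) B).
  exists M => t y y1; rewrite stepE mulrC (le_trans (dual_ub _ _))// ler_wpM2l//.
  exact: ab_free_unit.
have [lin [C CP]] := IH (ltnW h) jk.
have {}jk : j != rho (Ordinal h).
  by apply: contraTneq jk => ->; rewrite permK /= ltnn.
split=> [y a t1 t2|] /=.
  rewrite !dfwithout// -(@dual_linear _ _ (x _)); congr (x _ _).
  by apply: dual_ext => u; rewrite dualDE dualZE /= lin.
exists (`|x (rho (Ordinal h))| * C) => t; rewrite -mulrA dfwithout//.
exact: (@ab_step_unit _ _ _ _ (Ordinal h) _ _ _ (CP t)).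
Qed.

Lemma aron_berner_partial_pred (A : mlinear E F) x j (f : dual F) :
  (fun t => aron_berner rho A (dfwith x j t) f : R^o) \in @dual_pred R (dual (dual (E j))).
Proof.
have [lin [C CP]] := ab_comp_linear_bounded x (leqnn m) (ab_start rho f A) (ltn_ord ((rho^-1)%g j)).
apply: (@dual_predP _ _ _ C); first exact: lin.
by move=> t; apply: CP => i; rewrite normr0.
Qed.

(** Packaged as a functional on the bidual of [E j], so that [weakly_null] can be tested on it. *)
Definition aron_berner_partial (A : mlinear E F) x j (f : dual F) :
  dual (dual (dual (E j))) := Dual (aron_berner_partial_pred A x j f).

Lemma aron_berner_expansion (A : mlinear E F) : finite_rank A ->
  exists k (f : 'I_k -> dual F) (psi : 'I_k -> dual (dual F)),
    forall x, aron_berner rho A x = \sum_l aron_berner rho A x (f l) *: psi l.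
Proof.
move=> [n [b Ab]].
have [k [f [psi fP]]] := dual_common_kernel_proj (fun i => bidual_eval (b i)).
exists k, f, psi => x; apply: dual_ext => u; apply/eqP; rewrite -subr_eq0 dual_suml.
(* By linearity the difference is the value of [aron_berner rho A x] at [u - \sum_l psi l u *: f l],
   which kills each [b i] and hence the range of [A]. *)
under eq_bigr do rewrite mulrC.
rewrite -dual_sumr -(linear_linB _ _ (@dual_linear _ _ _)).
apply/eqP/aron_berner_eq0 => y; set g := _ - _.
have : lin_span (range A) (A y) by apply: sub_lin_span; exists y.
rewrite Ab => /lin_span_rangeP[a ->]; rewrite dual_sumr big1// => i _.
by rewrite -[g (b i)]/(bidual_eval (b i) g) fP mulr0.
Qed.

End AronBernerTheory.

Unset Implicit Arguments.
Set Strict Implicit.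
Set Printing Implicit Defensive.

Theorem proposition2p3 (R : realType) (m : nat)
    (E : 'I_m -> banachLatticeType R) (G : completeNormedModType R)
    (A : mlinear (fun i => E i) G) (A_finite_rank : finite_rank A)
    (rho : 'S_m) :
  finite_rank (aron_berner rho A) /\
  separately_almost_DP
    (E := fun i => dual (dual (E i)) : banachLatticeType R)
    (aron_berner rho A).
Proof.
have [k [f [psi ABE]]] := aron_berner_expansion rho A_finite_rank.
split.
  (* The [psi l] may lie outside the span of the range; they only provide a finite-dimensional space
     containing it. *)
  apply: (@subspace_finite_dim _ _ _ psi); first exact: lin_span_subspace.
  apply: lin_span_min; first exact: lin_span_subspace.
  move=> _ [x _ <-]; rewrite ABE; apply: subspace_sum; first exact: lin_span_subspace.
  by move=> i; apply: sub_lin_span; exists i.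
move=> j x.
pose g l := @aron_berner_partial _ _ (fun i => E i) _ rho A x j (f l).
have TE : (fun t => aron_berner rho A (dfwith x j t)) = (fun t => \sum_l g l t *: psi l).
  by apply/funext => t; rewrite ABE.
rewrite TE.
have lin : linear (fun t => \sum_l g l t *: psi l).
  move=> a t u; rewrite scaler_sumr -big_split; apply: eq_bigr => l _.
  by rewrite (@dual_linear _ _ (g l)) scalerDl scalerA.
split; first exact: lin.
  by move=> t; apply: (cvg_sumZr (FF := nbhs_filter t)) => l; exact: dual_continuous.
(* Writing the limit as a combination with zero coefficients reduces the claim to [g l (s n)]
   tending to 0 for each [l]. *)
move=> s _ s0; have w0 : \sum_(l < k) (0 : R) *: psi l = 0.
  by rewrite big1// => l _; rewrite scale0r.
by rewrite -[X in _ --> X]w0; apply: cvg_sumZr => l; exact: s0.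
Qed.
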